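(* Let $G$ be a finite group and let $\{N_1,\ldots,N_k\}$ be a set of normal subgroups of $G$. Then $\mathcal{K}=\{N^{\circ} : N\in A(N_1,\ldots,N_k),\ N^{\circ}\neq\emptyset\}$ is a superclass theory of $G$.
   Context: Let $G$ be a finite group with identity $e$ (also written $1$), and let $N(G)$ be the set of all normal subgroups of $G$. For $\{N_1,\ldots,N_k\}\subseteq N(G)$, $A(N_1,\ldots,N_k)$ is the smallest subset of $N(G)$ that contains $\{e\}$, $G$ and $N_1,\ldots,N_k$ and is closed under products $(H,K)\mapsto HK$ and intersections. For $N\in A(N_1,\ldots,N_k)$ put $$N^{\circ}=N\setminus \bigcup_{K\in A(N_1,\ldots,N_k),\ K<N}K,$$ where $K<N$ means $K$ is a proper subgroup of $N$. Supercharacter theory: a pair $(\mathcal{X},\mathcal{K})$, where $\mathcal{X}$ is a partition of the set ${\rm Irr}(G)$ of irreducible complex characters of $G$ and $\mathcal{K}$ is a partition of $G$ (into nonempty parts), such that (a) $|\mathcal{X}|=|\mathcal{K}|$; (b) for each $X\in\mathcal{X}$ there is a nonzero character $\chi_X$ of $G$ whose irreducible constituents all lie in $X$ and which is constant on each part of $\mathcal{K}$; (c) $\{1\}\in\mathcal{K}$. The members of $\mathcal{K}$ are called the superclasses. Superclass theory: a partition $\mathcal{K}$ of $G$ satisfying one of the following two conditions, which are known to be equivalent: (1) $\mathcal{K}$ is the set of superclasses of a supercharacter theory of $G$; (2) $\{1\}\in\mathcal{K}$ and the $\mathbb{C}$-span of $\{\widehat{K}:K\in\mathcal{K}\}$ is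 a subring of the center $Z(\mathbb{C}[G])$ of the group algebra, where $\widehat{K}=\sum_{s\in K}s$. *)

(* Defs.v *)
From HB Require Import structures.
From mathcomp Require Import all_boot all_order all_algebra all_fingroup.
From mathcomp Require Import all_solvable all_field all_character.

Set Implicit Arguments.
Unset Strict Implicit.
Unset Printing Implicit Defensive.

Import GroupScope GRing.Theory.

(* Subgroups are represented by their underlying sets, so that [H * K] below is
   the setwise product and a family of subgroups has the type {set {set gT}}
   also used for partitions. *)

Section NormalSubgroupLattice.

Variables (gT : finGroupType) (G : {group gT}).

Definition normal_subgroups : {set {set gT}} :=
  [set N : {set gT} | group_set N && (N <| G)].

Definition closed_family (Ns B : {set {set gT}}) : bool :=
  [&& B \subset normal_subgroups,
      [set 1] \in B, (G : {set gT}) \in B, Ns \subset B &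
      [forall H in B, forall K in B, (H * K \in B) && (H :&: K \in B)]].

(* A(N_1, ..., N_k): when Ns consists of normal subgroups this is the smallest
   closed family, see [generated_family_closed] and [generated_family_min]. *)
Definition generated_family (Ns : {set {set gT}}) : {set {set gT}} :=
  \bigcap_(B in [set B | closed_family Ns B]) B.

(* N° relative to the family A. *)
Definition core_part (A : {set {set gT}}) (N : {set gT}) : {set gT} :=
  N :\: \bigcup_(K in A | K \proper N) K.

Definition core_parts (Ns : {set {set gT}}) : {set {set gT}} :=
  let A := generated_family Ns in
  [set core_part A N | N in A & core_part A N != set0].

Lemma normal_subgroups_closed (Ns : {set {set gT}}) :
  Ns \subset normal_subgroups -> closed_family Ns normal_subgroups.
Proof.
move=> sNs; apply/and5P; split=> //.
- by rewrite inE groupP normal1.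
- by rewrite inE groupP normal_refl.
apply/forall_inP=> H0; rewrite inE => /andP[gH nH].
apply/forall_inP=> K0; rewrite inE => /andP[gK nK].
pose H := Group gH; pose K := Group gK.
have eHK : H0 * K0 = H <*> K.
  by rewrite norm_joinEl // (subset_trans (normal_sub nH)) ?normal_norm.
rewrite !inE eHK groupP (normalY (A := H) (B := K)) //=.
by rewrite (groupP (H :&: K)%G) (normalI (A := H) (B := K)).
Qed.

Lemma generated_family_closed (Ns : {set {set gT}}) :
  Ns \subset normal_subgroups -> closed_family Ns (generated_family Ns).
Proof.
move=> /normal_subgroups_closed cN; apply/and5P; split.
- by apply: bigcap_inf; rewrite inE.
- by apply/bigcapP=> B; rewrite inE => /and5P[].
- by apply/bigcapP=> B; rewrite inE => /and5P[].
- by apply/bigcapsP=> B; rewrite inE => /and5P[].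
apply/forall_inP=> H /bigcapP AH; apply/forall_inP=> K /bigcapP AK.
apply/andP; split; apply/bigcapP=> B cB; move: (AH B cB) (AK B cB);
  move: cB; rewrite inE => /and5P[_ _ _ _ /forall_inP cB] BH BK;
  by have /forall_inP/(_ K BK)/andP[] := cB H BH.
Qed.

Lemma generated_family_min (Ns B : {set {set gT}}) :
  closed_family Ns B -> generated_family Ns \subset B.
Proof. by move=> cB; apply: bigcap_inf; rewrite inE. Qed.

End NormalSubgroupLattice.

Section SuperclassTheory.

Variables (gT : finGroupType) (G : {group gT}).

(* Irr(G) is indexed by Iirr G, so a partition of Irr(G) is a partition of
   [set: Iirr G]. As everywhere in the library's character theory, the field of
   algebraic numbers algC plays the role of the complex numbers. *)
Definition supercharacter_theory
    (XX : {set {set Iirr G}}) (KK : {set {set gT}}) : Prop :=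
  [/\ partition XX [set: Iirr G],
      partition KK G,
      #|XX| = #|KK|,
      (forall X, X \in XX -> exists chi : 'CF(G),
         [/\ chi \is a character, chi != 0%R,
             {subset irr_constt chi <= X} &
             forall K, K \in KK -> {in K &, forall x y, chi x = chi y}])
    & [set 1] \in KK].

(* The span of the class sums in the group algebra. The latter is group_ring,
   the linear span of the matrices of the regular representation; gset_mx sends
   K to the sum of the matrices of its elements. *)
Definition class_sum_span (KK : {set {set gT}}) :=
  (\sum_(K in KK) <<mxvec (gset_mx algC G K)>>)%MS.

Definition central_subring (m : nat) (S : 'A[algC]_(m, #|G|)) : bool :=
  [&& (S <= 'Z(group_ring algC G))%MS, (1%:M%R \in S)%MS & (S * S <= S)%MS].

(* The two defining conditions are known to be equivalent; demanding both makes
   the definition independent of that fact. *)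
Definition superclass_theory (KK : {set {set gT}}) : Prop :=
  [/\ partition KK G,
      (exists XX : {set {set Iirr G}}, supercharacter_theory XX KK)
    & ([set 1] \in KK) /\ central_subring (class_sum_span KK)].

End SuperclassTheory.

(* Main.v *)
Require Import Defs.
From mathcomp Require Import all_boot all_fingroup.
From mathcomp Require Import all_algebra all_field all_character.

(** Let A be the lattice of normal subgroups generated by the family. Each g in
    G lies in a smallest member of A, its hull, and N° consists of the g whose
    hull is N; so the nonempty N° partition G ([core_partE],
    [fibres_partition]). Dually, each irreducible character has a largest member
    of A contained in its kernel, its kernel core, and the nonempty sets X_N of
    irreducible characters with kernel core N partition Irr(G).

    The class sum of a member N of A is the sum of the class sums of the M° for
    M in A with M <= N. This system is unitriangular ([triangular_closed]), so
    the class sums of the M° and those of the members of A have the same span.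
    The product of the class sums of N and M is |N :&: M| times the class sum of
    NM ([gset_mxM]), hence the span is a subring; it is central because each M° is normalised by G.

    On the dual side, let sigma_N be the sum of the chi(1) chi for chi in X_N.
    The sum of the sigma_M for M in A with N <= M is the regular character of
    G / N lifted to G, which is |G : N| times the indicator of N
    ([sum_irr_kernel], [sum_supercharacters]). Inverting this system shows that
    sigma_N is constant on each M°. The sigma_N for X_N nonempty, and likewise
    the indicators of the nonempty N°, are orthogonal families of nonzero class
    functions, and by triangularity both span the space spanned by the
    indicators of the members of A. Hence there are as many nonempty X_N as
    nonempty N° ([card_superpartitions]). *)

Set Implicit Arguments.
Unset Strict Implicit.
Unset Printing Implicit Defensive.

Import GroupScope GRing.Theory Num.Theory.

(** * The partition of a set into the fibres of a map *)

Section Fibres.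

Variables (I J : finType) (D : {set I}) (f : I -> J) (A : {set J}).

(** The part of D on which f takes the value a; it may be empty. *)
Definition fibre (a : J) : {set I} := [set x in D | f x == a].

(** The nonempty fibres over the elements of A. *)
Definition fibres : {set {set I}} :=
  [set fibre a | a in A & fibre a != set0].

Lemma fibres_partition : {in D, forall x, f x \in A} -> partition fibres D.
Proof.
move=> fA; apply/and3P; split.
- apply/eqP/setP=> x; apply/bigcupP/idP => [[X /imsetP[a _ ->]] | Dx].
    by rewrite inE => /andP[].
  exists (fibre (f x)); last by rewrite inE Dx eqxx.
  apply: imset_f; rewrite inE fA //=.
  by apply/set0Pn; exists x; rewrite inE Dx eqxx.
- apply/trivIsetP=> _ _ /imsetP[a _ ->] /imsetP[b _ ->] neq_ab.
  rewrite -setI_eq0; apply: contraR neq_ab => /set0Pn[x].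
  by rewrite !inE => /andP[/andP[_ /eqP <-] /andP[_ /eqP <-]].
by apply/imsetP=> -[a]; rewrite inE => /andP[_ /eqP n0] /esym.
Qed.

Lemma card_fibres : #|fibres| = #|[set a in A | fibre a != set0]|.
Proof.
rewrite /fibres card_in_imset => [|a b].
  by apply: eq_card => a; rewrite inE.
rewrite !inE => /andP[_ /set0Pn[x ax]] _ eq_ab; have bx := ax.
rewrite eq_ab in bx; move: ax bx; rewrite !inE.
by move=> /andP[_ /eqP <-] /andP[_ /eqP].
Qed.

Lemma sum_fibres (V : nmodType) (F : I -> V) (r : rel J) (b : J) :
    {in D, forall x, f x \in A} ->
  (\sum_(x in D | r (f x) b) F x
     = \sum_(a in A | r a b) \sum_(x in fibre a) F x)%R.
Proof.
move=> fA; rewrite (partition_big f (fun a => (a \in A) && r a b)) => [|x].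
  apply: eq_bigr => a /andP[_ rab]; apply: eq_bigl => x; rewrite inE.
  by case: eqP => [->|_]; rewrite ?rab ?andbT ?andbF.
by case/andP=> /fA -> ->.
Qed.

End Fibres.

(** * Unitriangular systems and dimension counts *)

Section Triangular.

Variables (J : finType) (A : {set J}) (r : rel J) (rank : J -> nat).
(** The relation r is triangular on A: it is reflexive, and a strictly
    increasing rank separates distinct related elements. *)
Hypothesis rr : reflexive r.
Hypothesis rank_lt :
  {in A &, forall a b, r a b -> a != b -> rank a < rank b}.

(** Unitriangular inversion: each T b is an integral combination of the S a. *)
Lemma triangular_closed (V : zmodType) (P : {pred V}) (S T : J -> V) :
    GRing.zmod_closed P ->
    {in A, forall b, S b = \sum_(a in A | r a b) T a}%R ->
  {in A, forall b, S b \in P} -> {in A, forall b, T b \in P}.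
Proof.
move=> [P0 PB] eST PS b; have [n] := ubnP (rank b).
elim: n b => // n IHn b; rewrite ltnS => le_b_n Ab.
have := eST b Ab; rewrite (bigD1 b) ?Ab ?rr //= => /(canLR (addrK _)) <-.
apply: (PB); first exact: PS.
have PD x y : x \in P -> y \in P -> (x + y)%R \in P.
  by move=> Px Py; rewrite -(opprK y); apply: (PB) => //; rewrite -sub0r (PB).
elim/big_ind: _ => // a /andP[/andP[Aa rab] neq_ab].
by apply: IHn => //; apply: leq_trans le_b_n; apply: rank_lt.
Qed.

Lemma triangular_span (F : fieldType) (V : vectType F) (S T : J -> V) :
    {in A, forall b, S b = \sum_(a in A | r a b) T a}%R ->
  (\sum_(a in A) <[S a]> = \sum_(a in A) <[T a]>)%VS.
Proof.
have mem_span (R : J -> V) a : a \in A -> R a \in (\sum_(a in A) <[R a]>)%VS.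
  by move=> Aa; apply/(subvP (sumv_sup a Aa (subvv _)))/memv_line.
move=> eST; apply/eqP; rewrite eqEsubv; apply/andP; split.
  apply/subv_sumP => b Ab; rewrite -memvE eST //.
  by apply: rpred_sum => a /andP[Aa _]; apply: mem_span.
apply/subv_sumP=> b Ab; rewrite -memvE.
apply: (triangular_closed _ eST) b Ab => [|a]; last exact: mem_span.
by split=> [|x y]; [apply: rpred0 | apply: rpredB].
Qed.

End Triangular.

(** Zero vectors are allowed in the family, and do not count. *)
Lemma dim_orthogonal_span (gT : finGroupType) (G : {group gT}) (J : finType)
    (A : {set J}) (T : J -> 'CF(G)) :
    {in A &, forall a b, a != b -> '[T a, T b]%R = 0%R} ->
  \dim (\sum_(a in A) <[T a]>)%VS = #|[set a in A | T a != 0%R]|.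
Proof.
move=> oT; set B := [set a in A | _].
have -> : (\sum_(a in A) <[T a]> = <<[seq T a | a <- enum B]>>)%VS.
  rewrite span_def big_map big_enum /= (bigID (fun a => T a != 0%R)) /=.
  rewrite [X in (_ + X)%VS]big1 ?addv0 => [|a /andP[_ /negbNE/eqP ->]].
    by apply: eq_bigl => a; rewrite inE.
  by apply/eqP; rewrite -subv0 -memvE mem0v.
have injT : {in B &, injective T}.
  move=> a b; rewrite !inE => /andP[Aa nza] /andP[Ab nzb] eqT.
  apply/eqP; apply: contraNT nza => /(oT a b Aa Ab).
  by rewrite -eqT => /eqP; rewrite cfnorm_eq0.
have /orthogonal_free: pairwise_orthogonal [seq T a | a <- enum B].
  apply/pairwise_orthogonalP; split.
    rewrite /= map_inj_in_uniq ?enum_uniq ?andbT; last first.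
      by move=> a b; rewrite !mem_enum; apply: injT.
    by apply/mapP=> -[a]; rewrite mem_enum inE => /andP[_ /eqP nz] /esym.
  move=> _ _ /mapP[a + ->] /mapP[b + ->]; rewrite !mem_enum !inE.
  move=> /andP[Aa _] /andP[Ab _] neqT; apply: oT => //.
  by apply: contraNneq neqT => ->.
by rewrite /free => /eqP ->; rewrite size_map -cardE.
Qed.

(** * Regular characters of quotients and products of class sums *)

(** Both sides are the regular character of G / H inflated to G. *)
Lemma sum_irr_kernel (gT : finGroupType) (G H : {group gT}) : H <| G ->
  (\sum_(i | H \subset cfker 'chi[G]_i) 'chi_i 1%g *: 'chi_i
     = #|G : H|%:R *: '1_H)%R.
Proof.
move=> nsHG; rewrite (reindex _ (mod_Iirr_bij nsHG)) /=.
transitivity (cfReg (G / H) %% H)%CF.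
  rewrite cfReg_sum linear_sum /=; apply: eq_big => [i | i _].
    by rewrite mod_IirrE ?cfker_mod.
  by rewrite linearZ /= mod_IirrE ?cfMod1.
apply/cfun_inP=> x Gx; rewrite cfModE // cfRegE cfunE cfuniE //.
have Nx : x \in 'N(H) by apply: subsetP Gx; apply: normal_norm.
rewrite card_quotient ?normal_norm // -mulr_natr.
congr (_ * (nat_of_bool _)%:R)%R.
by apply/eqP/idP => [/coset_idr -> // | /coset_id].
Qed.

Section GroupSums.

Variables (F : fieldType) (gT : finGroupType) (G : {group gT}).

Lemma gset_mx_central (K : {set gT}) :
  K <| G -> (gset_mx F G K \in 'Z(group_ring F G))%MS.
Proof.
move=> /andP[sKG nKG]; rewrite sub_capmx; apply/andP; split.
  rewrite /gset_mx linear_sum summx_sub // => x Kx.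
  by apply: envelop_mx_id; apply: (subsetP sKG).
rewrite memmx_cent_envelop; apply/centgmxP=> y Gy.
rewrite /gset_mx mulmx_suml mulmx_sumr.
rewrite [RHS](reindex_inj (conjg_inj y)) /=; apply: eq_big => [x | x Kx].
  by rewrite memJ_norm ?(subsetP nKG).
have Gx := subsetP sKG x Kx.
by rewrite -!repr_mxM ?groupJ // -conjgC.
Qed.

Lemma gset_mxM (H K : {group gT}) : H \subset G -> K \subset G ->
  (gset_mx F G H *m gset_mx F G K = #|H :&: K|%:R *: gset_mx F G (H * K)%g)%R.
Proof.
move=> sHG sKG; rewrite /gset_mx mulmx_sumr scaler_sumr.
transitivity (\sum_(y in K) \sum_(z in H :* y) regular_repr F G z)%R.
  apply: eq_bigr => y Ky; rewrite mulmx_suml.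
  rewrite [RHS](reindex_inj (mulIg y)) /=.
  apply: eq_big => [x | x Hx]; first by rewrite mem_rcoset mulgK.
  by rewrite repr_mxM ?(subsetP sHG x) ?(subsetP sKG y).
(* Count, for each z in H * K, the y in K with z \in H :* y. *)
rewrite (exchange_big_dep [in H * K]) /= => [|y z Ky]; last first.
  by case/rcosetP=> x Hx ->; apply: mem_mulg.
apply: eq_bigr => z /mulsgP[x y Hx Ky ->].
rewrite sumr_const scaler_nat; congr (_ *+ _)%R.
(* For z = x * y these elements form the coset (H :&: K) :* y. *)
rewrite -[RHS](card_rcoset _ y); apply: eq_card => u.
rewrite unfold_in /= !mem_rcoset inE [u * y^-1 \in K]groupMr ?groupV // andbC.
by rewrite -mulgA groupMl // -groupV invMg invgK.
Qed.

End GroupSums.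

Lemma mulsmx_span_sub (F : fieldType) (n : nat) (J : finType) (P : pred J)
    (X : J -> 'M[F]_n) (m : nat) (S : 'A[F]_(m, n)) :
    {in P &, forall a b, X a *m X b \in S}%MS ->
  ((\sum_(a | P a) <<mxvec (X a)>>) * (\sum_(a | P a) <<mxvec (X a)>>) <= S)%MS.
Proof.
move=> XS; apply/mulsmx_subP=> _ _ /memmx_sumsP[B -> XB] /memmx_sumsP[C -> XC].
have scaleX a (Y : 'M_n) : (Y \in <<mxvec (X a)>>)%MS ->
    exists c, Y = (c *: X a)%R.
  rewrite genmxE => /sub_rVP[c eY]; exists c.
  by apply: (can_inj mxvecK); rewrite linearZ.
rewrite mulmx_suml linear_sum summx_sub // => a Pa.
rewrite mulmx_sumr linear_sum summx_sub // => b Pb.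
have [[c ->] [d ->]] := (scaleX a _ (XB a), scaleX b _ (XC b)).
by rewrite -scalemxAl -scalemxAr !linearZ !scalemx_sub // XS.
Qed.

(** * Hulls and kernel cores in a lattice of normal subgroups *)

Section ClosedFamily.

Variables (gT : finGroupType) (G : {group gT}) (Ns A : {set {set gT}}).
Hypothesis cA : closed_family G Ns A.

Lemma closed_family_group N : N \in A -> exists2 H : {group gT}, N = H & H <| G.
Proof.
have /and5P[/subsetP sA _ _ _ _] := cA => /sA; rewrite inE => /andP[gN nN].
by exists (Group gN).
Qed.

Lemma closed_family_normal N : N \in A -> N <| G.
Proof. by case/closed_family_group=> H ->. Qed.

Lemma closed_family1 : [set 1] \in A. Proof. by case/and5P: cA. Qed.
Lemma closed_familyG : (G : {set gT}) \in A. Proof. by case/and5P: cA. Qed.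

Lemma closed_familyM : {in A &, forall H K, H * K \in A}.
Proof.
have /and5P[_ _ _ _ /forall_inP cMI] := cA => H K AH AK.
by have /forall_inP/(_ K AK)/andP[] := cMI H AH.
Qed.

Lemma closed_familyI : {in A &, forall H K, H :&: K \in A}.
Proof.
have /and5P[_ _ _ _ /forall_inP cMI] := cA => H K AH AK.
by have /forall_inP/(_ K AK)/andP[] := cMI H AH.
Qed.

(** The smallest member of A containing x, for x in G; it is found as a member
    of least order, which is unique by stability under intersection. *)
Definition normal_hull (x : gT) : {set gT} :=
  [arg min_(N < (G : {set gT}) | (N \in A) && (x \in N)) #|N|].

Lemma normal_hull_in x : x \in G -> normal_hull x \in A.
Proof.
rewrite /normal_hull => Gx.
by case: arg_minnP => [|N /andP[]]; rewrite ?closed_familyG.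
Qed.

Lemma normal_hull_sub x N :
  x \in G -> N \in A -> (normal_hull x \subset N) = (x \in N).
Proof.
rewrite /normal_hull => Gx AN.
case: arg_minnP => [|M /andP[AM Mx] minM]; first by rewrite closed_familyG.
apply/idP/idP => [/subsetP-> // | Nx].
apply/setIidPl/eqP; rewrite eqEcard subsetIl minM //.
by rewrite closed_familyI // inE Mx.
Qed.

(** The largest member of A contained in the kernel of 'chi_i; it is found as a
    member of greatest order, which is unique by stability under products. *)
Definition kernel_core (i : Iirr G) : {set gT} :=
  [arg max_(N > [set 1 : gT] | (N \in A) && (N \subset cfker ('chi_i)%R)) #|N|].

Lemma kernel_core_base i :
  ([set 1] \in A) && ([set 1] \subset cfker ('chi[G]_i)%R).
Proof. by rewrite closed_family1 sub1G. Qed.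

Lemma kernel_core_in i : kernel_core i \in A.
Proof.
rewrite /kernel_core.
by case: arg_maxnP => [|N /andP[]]; rewrite ?kernel_core_base.
Qed.

Lemma sub_kernel_core i N :
  N \in A -> (N \subset kernel_core i) = (N \subset cfker ('chi_i)%R).
Proof.
rewrite /kernel_core => AN.
case: arg_maxnP => [|M /andP[AM kM] maxM]; first exact: kernel_core_base.
apply/idP/idP => [sNM | kN]; first exact: subset_trans kM.
have [H defN _] := closed_family_group AN.
have [K defM _] := closed_family_group AM.
have /eqP -> : M == M * N.
  rewrite eqEcard; apply/andP; split; first by rewrite defM defN mulG_subl.
  by apply: maxM; rewrite closed_familyM //= mul_subG.
by rewrite defM defN mulG_subr.
Qed.

Lemma core_partE N : N \in A -> core_part A N = fibre G normal_hull N.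
Proof.
move=> AN; have [H defN /normal_sub sHG] := closed_family_group AN.
apply/setP=> x; rewrite !inE; apply/andP/andP => [[notUx Nx] | [Gx /eqP hx]].
  have Gx : x \in G by rewrite defN in Nx; apply: (subsetP sHG).
  split=> //; have := normal_hull_sub Gx AN; rewrite Nx subEproper.
  case/orP=> // ltN; case/bigcupP: notUx; exists (normal_hull x).
    by rewrite normal_hull_in.
  by rewrite -normal_hull_sub ?normal_hull_in.
split; last by rewrite -normal_hull_sub // hx.
apply/bigcupP=> -[K /andP[AK]]; rewrite properE => /andP[_ /negP nNK].
by rewrite -normal_hull_sub // hx.
Qed.

Lemma core_part_normal N : N \in A -> core_part A N <| G.
Proof.
move=> AN; have /andP[sNG nNG] := closed_family_normal AN.
rewrite /normal subDset subsetU ?sNG ?orbT // normsD // norms_bigcup //.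
by apply/bigcapsP=> K /andP[/closed_family_normal/andP[]].
Qed.

Lemma core_part1 : core_part A [set 1] = [set 1].
Proof.
rewrite /core_part big1 ?setD0 // => K /andP[/closed_family_group[H -> _]].
by move/proper_card; rewrite cards1 ltnNge cardG_gt0.
Qed.

Lemma core_parts_fibres :
  [set core_part A N | N in A & core_part A N != set0]
    = fibres G normal_hull A.
Proof.
apply/setP=> X; apply/imsetP/imsetP=> -[N]; rewrite inE => /andP[AN nz] ->;
  by exists N; rewrite ?core_partE // inE AN -?core_partE // core_partE in nz *.
Qed.

(** * Superclasses and supercharacters *)

Let sub_card_lt : {in A &, forall M N : {set gT},
  M \subset N -> M != N -> #|M| < #|N|}.
Proof. by move=> M N _ _ sMN neq; rewrite proper_card // properEneq neq. Qed.

Let sup_card_lt : {in A &, forall M N : {set gT},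
  N \subset M -> M != N -> #|~: M| < #|~: N|}.
Proof.
move=> M N _ _ sNM neq; rewrite proper_card // properEneq setCS sNM andbT.
by rewrite (inj_eq (@setC_inj _)).
Qed.

Lemma sum_core_parts (V : nmodType) (F : gT -> V) N : N \in A ->
  (\sum_(x in N) F x
     = \sum_(M in A | M \subset N) \sum_(x in core_part A M) F x)%R.
Proof.
move=> AN; have /andP[/subsetP sNG _] := closed_family_normal AN.
transitivity (\sum_(x in G | normal_hull x \subset N) F x)%R.
  apply: eq_bigl => x; apply/idP/andP=> [Nx | [Gx]].
    by rewrite normal_hull_sub ?sNG.
  by rewrite normal_hull_sub.
rewrite (sum_fibres (A := A) _ (fun M N : {set gT} => M \subset N)).
  by apply: eq_bigr => M /andP[AM _]; rewrite core_partE.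
by move=> x; apply: normal_hull_in.
Qed.

Lemma cfuni_core_parts N : N \in A ->
  ('1_N = \sum_(M in A | M \subset N) '1_(core_part A M) :> 'CF(G))%R.
Proof.
move=> AN; apply/cfun_inP=> x Gx.
have natE (B : {set gT}) : ((x \in B)%:R = \sum_(y in B) (y == x)%:R :> algC)%R.
  have [Bx | nBx] := boolP (x \in B).
    by rewrite (bigD1 x) //= eqxx big1 ?addr0 // => y /andP[_ /negPf ->].
  by rewrite big1 // => y By; case: eqP => // eq_yx; rewrite -eq_yx By in nBx.
rewrite cfuniE ?closed_family_normal // natE sum_core_parts //.
rewrite sum_cfunE; apply: eq_bigr => M /andP[AM _].
by rewrite cfuniE ?core_part_normal.
Qed.

(** The character sigma_N; it is zero when no irreducible character has kernel
    core N. *)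
Definition supercharacter (N : {set gT}) : 'CF(G) :=
  (\sum_(i in fibre setT kernel_core N) 'chi_i 1%g *: 'chi_i)%R.

Lemma sum_supercharacters N : N \in A ->
  (#|G : N|%:R *: '1_N = \sum_(M in A | N \subset M) supercharacter M)%R.
Proof.
move=> AN; have [H defN nsHG] := closed_family_group AN.
rewrite {1 2}defN -sum_irr_kernel //.
rewrite -(sum_fibres _ (fun M N : {set gT} => N \subset M)) => [|i _].
  by apply: eq_bigl => i; rewrite inE sub_kernel_core // defN.
exact: kernel_core_in.
Qed.

Lemma supercharacter_char N : supercharacter N \is a character.
Proof.
apply: rpred_sum => i _; have [n ->] := natrP (Cnat_irr1 i).
by rewrite scaler_nat rpredMn ?irr_char.
Qed.

Lemma cfdot_supercharacter N j :
  ('[supercharacter N, 'chi_j]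
     = 'chi_j 1%g *+ (j \in fibre setT kernel_core N))%R.
Proof.
rewrite cfdot_suml; have [Xj | nXj] := boolP (j \in fibre setT kernel_core N).
  rewrite (bigD1 j) //= cfdotZl cfdot_irr eqxx mulr1 big1 ?addr0 // => i.
  by case/andP=> _ /negPf neq_ij; rewrite cfdotZl cfdot_irr neq_ij mulr0.
rewrite big1 // => i Xi; rewrite cfdotZl cfdot_irr.
by case: eqP => [eq_ij | _]; [rewrite -eq_ij Xi in nXj | rewrite mulr0].
Qed.

Lemma supercharacter_eq0 N :
  (supercharacter N == 0%R) = (fibre setT kernel_core N == set0).
Proof.
apply/eqP/eqP=> [s0 | X0]; last by rewrite /supercharacter X0 big_set0.
apply/setP=> j; rewrite [RHS]inE; apply/negP=> Xj; have /negP[] := irr1_neq0 j.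
by have := cfdot_supercharacter N j; rewrite s0 Xj cfdot0l => /esym/eqP.
Qed.

Lemma supercharacter_ortho M N :
  M != N -> '[supercharacter M, supercharacter N]%R = 0%R.
Proof.
move=> neqMN; rewrite /supercharacter cfdot_sumr big1 // => j.
rewrite cfdotZr cfdot_supercharacter !inE /= => /eqP ->.
by rewrite eq_sym (negPf neqMN) mulr0.
Qed.

(** By inversion it suffices to treat the indicators of the members of A, for
    which x \in M if and only if the hull of x is contained in M. *)
Lemma supercharacter_const N : N \in A ->
  {in G &, forall x y, normal_hull x = normal_hull y ->
     supercharacter N x = supercharacter N y}.
Proof.
pose P := [pred phi : 'CF(G) | [forall x in G, forall y in G,
  (normal_hull x == normal_hull y) ==> (phi x == phi y)]].
suffices PN M : M \in A -> supercharacter M \in P.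
  move=> /PN /forall_inP Px x y Gx Gy eq_xy.
  by have /forall_inP/(_ y Gy) := Px x Gx; rewrite eq_xy eqxx => /eqP.
apply: (triangular_closed _ sup_card_lt _ sum_supercharacters) => {M} [M||M AM].
- exact: subxx.
- split=> [|phi psi /forall_inP Pphi /forall_inP Ppsi].
    apply/forall_inP=> x _; apply/forall_inP=> y _.
    by rewrite !cfunE eqxx implybT.
  apply/forall_inP=> x Gx; apply/forall_inP=> y Gy; apply/implyP=> eq_xy.
  have /forall_inP/(_ y Gy) := Pphi x Gx; have /forall_inP/(_ y Gy) := Ppsi x Gx.
  by rewrite !cfunE eq_xy => /eqP -> /eqP ->.
apply/forall_inP=> x Gx; apply/forall_inP=> y Gy.
apply/implyP=> /eqP eq_xy; rewrite !cfunE !cfuniE ?closed_family_normal //.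
by rewrite -(normal_hull_sub Gx AM) -(normal_hull_sub Gy AM) eq_xy.
Qed.

(** Both sides are the dimension of the span of the indicators '1_N, N in A. *)
Lemma card_superpartitions :
  #|fibres setT kernel_core A| = #|fibres G normal_hull A|.
Proof.
rewrite !card_fibres.
transitivity #|[set N in A | supercharacter N != 0%R]|.
  by apply: eq_card => N; rewrite !inE supercharacter_eq0.
transitivity #|[set N in A | '1_(core_part A N) != 0 :> 'CF(G)]%R|; last first.
  apply: eq_card => N; rewrite !inE; apply: andb_id2l => AN.
  rewrite -core_partE //; congr (~~ _).
  apply/eqP/eqP => [K0 | K0].
    apply/setP=> x; rewrite [RHS]inE; apply/idP=> Kx.
    have := cfuniE x (core_part_normal AN).
    by rewrite K0 cfunE Kx => /eqP; rewrite eq_sym oner_eq0.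
  by apply/cfun_inP=> x _; rewrite cfuniE ?core_part_normal // K0 inE cfunE.
rewrite -!dim_orthogonal_span => [|M N AM AN neqMN|M N _ _]; first 1 last.
- rewrite cfdot_cfuni ?core_part_normal // !core_partE //.
  suffices ->: fibre G normal_hull M :&: fibre G normal_hull N = set0.
    by rewrite cards0 mul0r.
  apply/setP=> x; rewrite !inE; apply: contraNF neqMN.
  by case/andP=> /andP[_ /eqP->] /andP[_].
- exact: supercharacter_ortho.
rewrite -(triangular_span _ sup_card_lt sum_supercharacters) => [|M]; last first.
  exact: subxx.
rewrite -(triangular_span _ sub_card_lt cfuni_core_parts) => [|M]; last first.
  exact: subxx.
congr (\dim _); apply: eq_bigr => N AN; apply/eqP.
have nz_index : (#|G : N|%:R != 0 :> algC)%R.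
  by rewrite pnatr_eq0 -lt0n indexg_gt0.
rewrite eqEsubv -!memvE; apply/andP; split; apply/vlineP.
  by exists #|G : N|%:R%R.
by exists (#|G : N|%:R^-1)%R; rewrite scalerA mulVf ?scale1r.
Qed.

Lemma core_parts_supercharacter :
  supercharacter_theory (fibres setT kernel_core A) (fibres G normal_hull A).
Proof.
split.
- by apply: fibres_partition => i _; apply: kernel_core_in.
- by apply: fibres_partition; apply: normal_hull_in.
- exact: card_superpartitions.
- move=> _ /imsetP[N + ->]; rewrite inE => /andP[AN XN]; exists (supercharacter N).
  split.
  + exact: supercharacter_char.
  + by rewrite supercharacter_eq0.
  + move=> j; rewrite irr_consttE cfdot_supercharacter.
    by case: (j \in _) => //; rewrite eqxx.
  move=> _ /imsetP[M + ->]; rewrite inE => /andP[AM _] x y; rewrite !inE.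
  move=> /andP[Gx /eqP hx] /andP[Gy /eqP hy].
  by apply: supercharacter_const => //; rewrite hx.
rewrite -core_parts_fibres; apply/imsetP; exists [set 1].
  rewrite inE closed_family1; apply/set0Pn; exists 1.
  by rewrite core_part1 set11.
by rewrite core_part1.
Qed.

Lemma core_parts_central_subring :
  central_subring (class_sum_span G
    [set core_part A N | N in A & core_part A N != set0]).
Proof.
set KK := [set _ | _ in _ & _]; set S := class_sum_span G KK.
have S_core N : N \in A -> (gset_mx algC G (core_part A N) \in S)%MS.
  move=> AN; have [-> | nz] := eqVneq (core_part A N) set0.
    by rewrite /gset_mx big_set0 linear0 sub0mx.
  apply: (sumsmx_sup (core_part A N)); last by rewrite genmxE.
  by apply: imset_f; rewrite inE AN.
have gsetE N : N \in A -> gset_mx algC G N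
    = (\sum_(M in A | M \subset N) gset_mx algC G (core_part A M))%R.
  exact: sum_core_parts.
have S_full N : N \in A -> (gset_mx algC G N \in S)%MS.
  move=> AN; rewrite gsetE // linear_sum summx_sub // => M /andP[AM _].
  exact: S_core.
apply/and3P; split.
- apply/sumsmx_subP=> _ /imsetP[N + ->]; rewrite inE genmxE => /andP[AN _].
  by apply: gset_mx_central; apply: core_part_normal.
- have := S_full _ closed_family1; rewrite /gset_mx big_set1.
  by rewrite repr_mx1.
(* These closures reduce products of the M° class sums, one factor at a time,
   to products of class sums of members of A. *)
have zS (X : 'M[algC]_#|G|) : GRing.zmod_closed [pred B | (B *m X \in S)%MS]
    /\ GRing.zmod_closed [pred B | (X *m B \in S)%MS].
  split; split=> [|B C]; rewrite !inE ?mul0mx ?mulmx0 ?linear0 ?sub0mx //.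
    by rewrite mulmxBl linearB => SB SC; rewrite addmx_sub // eqmx_opp.
  by rewrite mulmxBr linearB => SB SC; rewrite addmx_sub // eqmx_opp.
apply: mulsmx_span_sub => _ _ /imsetP[M + ->] /imsetP[N + ->].
rewrite !inE => /andP[AM _] /andP[AN _].
move: M AM; apply: (triangular_closed _ sub_card_lt (zS _).1 gsetE) => [M|M AM].
  exact: subxx.
rewrite inE; move: N AN.
apply: (triangular_closed _ sub_card_lt (zS _).2 gsetE) => [N|N AN].
  exact: subxx.
rewrite inE; have [H defM /normal_sub sHG] := closed_family_group AM.
have [K defN /normal_sub sKG] := closed_family_group AN.
rewrite defM defN gset_mxM // linearZ scalemx_sub //.
by apply: S_full; rewrite -defM -defN closed_familyM.
Qed.

End ClosedFamily.

Theorem theorem3p3 (gT : finGroupType) (G : {group gT}) (Ns : {set {set gT}}) :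
  Ns \subset normal_subgroups G -> superclass_theory G (core_parts G Ns).
Proof.
move=> /generated_family_closed cA.
have KKE := core_parts_fibres cA; have sct := core_parts_supercharacter cA.
have [_ partKK _ _ KK1] := sct.
rewrite /superclass_theory {1 2 3}/core_parts KKE; split=> //.
  by exists (fibres setT (kernel_core (generated_family G Ns))
               (generated_family G Ns)).
by split=> //; apply: core_parts_central_subring cA.
Qed.
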